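(* Moisil's logic $\mathcal{LM}$ is equivalent to the De Morgan Heyting logic $\mathcal{DMH}$.
   Context: Language: $\langle\vee,\wedge,\to,\sim,\bot,\top\rangle$ of arities $2,2,2,1,0,0$. The abbreviation $\alpha\to_H\beta$ stands for $\alpha\to(\alpha\wedge\beta)$. The logic $\mathcal{DHMSH}$ is the Hilbert-style logic with axiom schemes: (A1) $\alpha\to_H(\alpha\vee\beta)$; (A2) $\beta\to_H(\alpha\vee\beta)$; (A3) $(\alpha\to_H\gamma)\to_H[(\beta\to_H\gamma)\to_H((\alpha\vee\beta)\to_H\gamma)]$; (A4) $(\alpha\wedge\beta)\to_H\alpha$; (A5) $(\gamma\to_H\alpha)\to_H[(\gamma\to_H\beta)\to_H(\gamma\to_H(\alpha\wedge\beta))]$; (A6) $\top$; (A7) $\bot\to_H\alpha$; (A8) $((\alpha\wedge\beta)\to_H\gamma)\to_H(\alpha\to_H(\beta\to_H\gamma))$; (A9) $(\alpha\to_H(\beta\to_H\gamma))\to_H((\alpha\wedge\beta)\to_H\gamma)$; (A10) $(\alpha\to_H\beta)\to_H((\beta\to_H\alpha)\to_H((\alpha\to\gamma)\to_H(\beta\to\gamma)))$; (A11) $(\alpha\to_H\beta)\to_H((\beta\to_H\alpha)\to_H((\gamma\to\beta)\to_H(\gamma\to\alpha)))$; (A12) $\top\to_H{\sim}\bot$; (A13) ${\sim}\top\to_H\bot$; (A14) ${\sim}(\alpha\wedge\beta)\to_H({\sim}\alpha\vee{\sim}\beta)$; and rules (SMP): from $\phi$ and $\phi\to_H\gamma$ deduce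 $\gamma$; (SCP): from $\phi\to_H\gamma$ deduce ${\sim}\gamma\to_H{\sim}\phi$ (both rules may be applied to any formulas already derived from the premises). The logic $\mathcal{DMH}$ is the axiomatic extension of $\mathcal{DHMSH}$ (same rules) by the axiom schemes ${\sim}(\alpha\vee\beta)\to_H({\sim}\alpha\wedge{\sim}\beta)$; $({\sim}\alpha\wedge{\sim}\beta)\to_H{\sim}(\alpha\vee\beta)$; ${\sim}{\sim}\alpha\to_H\alpha$; $\alpha\to_H{\sim}{\sim}\alpha$; $(\alpha\wedge\beta)\to\alpha$. Moisil's logic $\mathcal{LM}$ (''logique modale'') is the expansion of the intuitionistic propositional calculus by a De Morgan negation $\sim$: it has the axiom schemes of the intuitionistic propositional calculus in $\vee,\wedge,\to,\bot,\top$ (for formulas of the expanded language), the axiom schemes $\alpha\to{\sim}{\sim}\alpha$ and ${\sim}{\sim}\alpha\to\alpha$, and the rules modus ponens (from $\alpha$, $\alpha\to\beta$ deduce $\beta$) and contraposition (from $\alpha\to\beta$ deduce ${\sim}\beta\to{\sim}\alpha$), applicable to all formulas derived from premises. Equivalence of the two logics means that they have the same consequence relation; they both correspond to the variety $\mathbb{DMH}$ of De Morgan Heyting (symmetric Heyting) algebras, i.e. Heyting algebras with a unary operation ${}'$ satisfying $0'\approx1$, $1'\approx0$, $(x\wedge y)'\approx x'\vee y'$, $(x\vee y)'\approx x'\wedge y'$, $x''\approx x$. *)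

(* Defs.v *)
(* Hilbert systems over the language <\/, /\, ->, ~, bot, top>; Stdlib only. *)

Inductive form (V : Type) : Type :=
| Var : V -> form V
| Or  : form V -> form V -> form V
| And : form V -> form V -> form V
| Imp : form V -> form V -> form V
| Neg : form V -> form V
| Bot : form V
| Top : form V.

Arguments Var {V} _.
Arguments Or {V} _ _.
Arguments And {V} _ _.
Arguments Imp {V} _ _.
Arguments Neg {V} _.
Arguments Bot {V}.
Arguments Top {V}.

Definition ImpH {V : Type} (a b : form V) : form V := Imp a (And a b).

Declare Scope form_scope.
Delimit Scope form_scope with form.
Bind Scope form_scope with form.

Notation "a \/ b" := (Or a b) : form_scope.
Notation "a /\ b" := (And a b) : form_scope.
Notation "~ a" := (Neg a) : form_scope.
Notation "a --> b" := (Imp a b) (at level 90, right associativity) : form_scope.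
Notation "a -->h b" := (ImpH a b) (at level 90, right associativity) : form_scope.

Inductive DHMSH_axiom {V : Type} : form V -> Prop :=
| A1 a b : DHMSH_axiom (a -->h (a \/ b))
| A2 a b : DHMSH_axiom (b -->h (a \/ b))
| A3 a b c : DHMSH_axiom ((a -->h c) -->h ((b -->h c) -->h ((a \/ b) -->h c)))
| A4 a b : DHMSH_axiom ((a /\ b) -->h a)
| A5 a b c : DHMSH_axiom ((c -->h a) -->h ((c -->h b) -->h (c -->h (a /\ b))))
| A6 : DHMSH_axiom Top
| A7 a : DHMSH_axiom (Bot -->h a)
| A8 a b c : DHMSH_axiom (((a /\ b) -->h c) -->h (a -->h (b -->h c)))
| A9 a b c : DHMSH_axiom ((a -->h (b -->h c)) -->h ((a /\ b) -->h c))
| A10 a b c :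
    DHMSH_axiom ((a -->h b) -->h ((b -->h a) -->h ((a --> c) -->h (b --> c))))
| A11 a b c :
    DHMSH_axiom ((a -->h b) -->h ((b -->h a) -->h ((c --> b) -->h (c --> a))))
| A12 : DHMSH_axiom (Top -->h ~ Bot)
| A13 : DHMSH_axiom (~ Top -->h Bot)
| A14 a b : DHMSH_axiom (~ (a /\ b) -->h (~ a \/ ~ b)).

(* The first implication of DMH_heyting is the primitive one, not [-->h]:
   this is what makes the semi-Heyting implication a Heyting implication. *)
Inductive DMH_axiom {V : Type} : form V -> Prop :=
| DMH_base a : DHMSH_axiom a -> DMH_axiom a
| DMH_neg_or_l a b : DMH_axiom (~ (a \/ b) -->h (~ a /\ ~ b))
| DMH_neg_or_r a b : DMH_axiom ((~ a /\ ~ b) -->h ~ (a \/ b))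
| DMH_dne a : DMH_axiom (~ ~ a -->h a)
| DMH_dni a : DMH_axiom (a -->h ~ ~ a)
| DMH_heyting a b : DMH_axiom ((a /\ b) --> a).

(* Derivability from the premises G with the rules (SMP) and (SCP); the latter
   applies to everything derived from G, not only to theorems. *)
Inductive semi_derives {V : Type} (Ax G : form V -> Prop) : form V -> Prop :=
| semi_ax a : Ax a -> semi_derives Ax G a
| semi_prem a : G a -> semi_derives Ax G a
| semi_SMP a b :
    semi_derives Ax G a -> semi_derives Ax G (a -->h b) -> semi_derives Ax G b
| semi_SCP a b :
    semi_derives Ax G (a -->h b) -> semi_derives Ax G (~ b -->h ~ a).

Definition DHMSH_derives {V : Type} (G : form V -> Prop) (a : form V) : Prop :=
  semi_derives DHMSH_axiom G a.

Definition DMH_derives {V : Type} (G : form V -> Prop) (a : form V) : Prop :=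
  semi_derives DMH_axiom G a.

(* A standard axiomatization of the intuitionistic propositional calculus,
   instantiated at all formulas of the expanded language. *)
Inductive IPC_axiom {V : Type} : form V -> Prop :=
| IPC_K a b : IPC_axiom (a --> (b --> a))
| IPC_S a b c : IPC_axiom ((a --> (b --> c)) --> ((a --> b) --> (a --> c)))
| IPC_and_l a b : IPC_axiom ((a /\ b) --> a)
| IPC_and_r a b : IPC_axiom ((a /\ b) --> b)
| IPC_and_intro a b : IPC_axiom (a --> (b --> (a /\ b)))
| IPC_or_l a b : IPC_axiom (a --> (a \/ b))
| IPC_or_r a b : IPC_axiom (b --> (a \/ b))
| IPC_or_elim a b c :
    IPC_axiom ((a --> c) --> ((b --> c) --> ((a \/ b) --> c)))
| IPC_bot a : IPC_axiom (Bot --> a)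
| IPC_top : IPC_axiom Top.

Inductive LM_axiom {V : Type} : form V -> Prop :=
| LM_IPC a : IPC_axiom a -> LM_axiom a
| LM_dni a : LM_axiom (a --> ~ ~ a)
| LM_dne a : LM_axiom (~ ~ a --> a).

Inductive LM_derives {V : Type} (G : form V -> Prop) : form V -> Prop :=
| LM_ax a : LM_axiom a -> LM_derives G a
| LM_prem a : G a -> LM_derives G a
| LM_MP a b : LM_derives G a -> LM_derives G (a --> b) -> LM_derives G b
| LM_CP a b : LM_derives G (a --> b) -> LM_derives G (~ b --> ~ a).

(* A logic is identified with its consequence relation. *)
Definition logic_equivalent {V : Type}
  (L1 L2 : (form V -> Prop) -> form V -> Prop) : Prop :=
  forall (G : form V -> Prop) (a : form V), L1 G a <-> L2 G a.

(* Main.v *)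
Require Import Defs.

(** Both logics are presentations of the variety of symmetric (De Morgan)
    Heyting algebras, and they are compared through that variety rather than by
    translating derivations into one another.

    To a set [G] of premises each logic attaches a provability preorder on
    formulas: [G |- a --> b] for Moisil's logic, [G |- a -->h b] for the De
    Morgan Heyting logic.  A symmetric Heyting preorder is a preorder on formulas
    whose quotient is a symmetric Heyting algebra.  Two facts suffice:
    - soundness ([LM_sound], [DMH_sound]): in a symmetric Heyting preorder where
      the premises are above [Top], so is every formula derived by either logic;
    - completeness ([LM_sym_heyting], [DMH_sym_heyting]): the provability
      preorder of each logic is a symmetric Heyting preorder, and a formula above
      [Top] in it is derivable.
    Soundness of each logic in the preorder of the other gives both inclusions.

    Soundness rests on the fact that [a --> b] and [a -->h b] agree in a Heyting
    algebra.  The work is in [DMH_sym_heyting].  There the axioms (A1)--(A9)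
    together with the two congruence axioms (A10), (A11) make [-->h] a Heyting
    implication; reflexivity and transitivity are not among the axioms and are
    extracted by congruence from the fact that [a -->h b] is literally
    [a --> (a /\ b)].  It remains to see that the primitive implication is
    equivalent to [-->h].  Under [a], the formula [a --> b] becomes [Top --> b],
    which entails [b] ([le_Imp_ImpH]); under [a -->h b], the derivable formula
    [(a /\ b) --> b] becomes [a --> b] ([le_ImpH_Imp]).  Only the latter uses the
    axiom [(a /\ b) --> a]. *)

(** * Symmetric Heyting preorders *)

(** A preorder on formulas for which the connectives are the operations of a
    symmetric Heyting algebra, up to the induced equivalence.  That [~] exchanges
    [Top] with [Bot] and meets with joins follows from its being an antitone
    involution. *)
Record sym_heyting {V : Type} (le : form V -> form V -> Prop) : Prop := {
  sh_refl : forall a, le a a;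
  sh_trans : forall a b c, le a b -> le b c -> le a c;
  sh_top : forall a, le a Top;
  sh_bot : forall a, le Bot a;
  sh_andl : forall a b, le (a /\ b)%form a;
  sh_andr : forall a b, le (a /\ b)%form b;
  sh_and : forall a b c, le c a -> le c b -> le c (a /\ b)%form;
  sh_orl : forall a b, le a (a \/ b)%form;
  sh_orr : forall a b, le b (a \/ b)%form;
  sh_or : forall a b c, le a c -> le b c -> le (a \/ b)%form c;
  sh_intro : forall a b c, le (a /\ b)%form c -> le a (b --> c)%form;
  sh_elim : forall a b c, le a (b --> c)%form -> le (a /\ b)%form c;
  sh_neg : forall a b, le a b -> le (~ b)%form (~ a)%form;
  sh_dni : forall a, le a (~ ~ a)%form;
  sh_dne : forall a, le (~ ~ a)%form a }.

Section SymHeyting.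

Context {V : Type} (le : form V -> form V -> Prop) (H : sym_heyting le).

Lemma sh_proj1 a b c : le a c -> le (a /\ b)%form c.
Proof. intro h; exact (sh_trans _ H _ _ _ (sh_andl _ H a b) h). Qed.

Lemma sh_proj2 a b c : le b c -> le (a /\ b)%form c.
Proof. intro h; exact (sh_trans _ H _ _ _ (sh_andr _ H a b) h). Qed.

Lemma sh_mp h a b : le h (a --> b)%form -> le h a -> le h b.
Proof.
intros hab ha; apply (sh_trans _ H _ (h /\ a)%form).
- apply (sh_and _ H); [apply (sh_refl _ H) | exact ha].
- apply (sh_elim _ H); exact hab.
Qed.

Lemma sh_introH h a b : le (h /\ a)%form b -> le h (a -->h b)%form.
Proof.
intro hb; apply (sh_intro _ H), (sh_and _ H); [apply (sh_andr _ H) | exact hb].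
Qed.

Lemma sh_mpH h a b : le h (a -->h b)%form -> le h a -> le h b.
Proof.
intros hab ha; apply (sh_trans _ H _ (a /\ b)%form).
- exact (sh_mp _ _ _ hab ha).
- apply (sh_andr _ H).
Qed.

Lemma sh_le_top a b : le Top (a --> b)%form -> le a b.
Proof.
intro h; apply (sh_mp _ a); [| apply (sh_refl _ H)].
exact (sh_trans _ H _ _ _ (sh_top _ H a) h).
Qed.

Lemma sh_le_topH a b : le Top (a -->h b)%form -> le a b.
Proof.
intro h; apply (sh_mpH _ a); [| apply (sh_refl _ H)].
exact (sh_trans _ H _ _ _ (sh_top _ H a) h).
Qed.

Lemma sh_top_le a b : le a b -> le Top (a --> b)%form.
Proof. intro h; apply (sh_intro _ H), sh_proj2, h. Qed.

Lemma sh_top_leH a b : le a b -> le Top (a -->h b)%form.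
Proof. intro h; apply sh_introH, sh_proj2, h. Qed.

Lemma sh_or_ctx h a b c :
  le (h /\ a)%form c -> le (h /\ b)%form c -> le (h /\ (a \/ b))%form c.
Proof.
intros ha hb.
apply (sh_mp _ h); [apply sh_proj2 | apply (sh_andl _ H)].
apply (sh_or _ H); apply (sh_intro _ H).
- apply (sh_trans _ H _ (h /\ a)%form); [| exact ha].
  apply (sh_and _ H); [apply (sh_andr _ H) | apply (sh_andl _ H)].
- apply (sh_trans _ H _ (h /\ b)%form); [| exact hb].
  apply (sh_and _ H); [apply (sh_andr _ H) | apply (sh_andl _ H)].
Qed.

Lemma sh_neg_or a b : le (~ (a \/ b))%form (~ a /\ ~ b)%form.
Proof.
apply (sh_and _ H); apply (sh_neg _ H); [apply (sh_orl _ H) | apply (sh_orr _ H)].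
Qed.

Lemma sh_or_neg a b : le (~ a /\ ~ b)%form (~ (a \/ b))%form.
Proof.
apply (sh_trans _ H _ _ _ (sh_dni _ H _)), (sh_neg _ H), (sh_or _ H).
- apply (sh_trans _ H _ _ _ (sh_dni _ H _)), (sh_neg _ H), (sh_andl _ H).
- apply (sh_trans _ H _ _ _ (sh_dni _ H _)), (sh_neg _ H), (sh_andr _ H).
Qed.

Lemma sh_neg_and a b : le (~ (a /\ b))%form (~ a \/ ~ b)%form.
Proof.
refine (sh_trans _ H _ _ _ (sh_neg _ H _ _ _) (sh_dne _ H _)).
apply (sh_and _ H); (eapply (sh_trans _ H); [apply (sh_neg _ H) | apply (sh_dne _ H)]).
- apply (sh_orl _ H).
- apply (sh_orr _ H).
Qed.

(* Proves [le h a] when [a] is [h] or one of its iterated conjuncts. *)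
Ltac conjunct :=
  first [ exact (sh_refl _ H _)
        | apply sh_proj2; conjunct
        | apply sh_proj1; conjunct ].

Lemma IPC_axiom_valid a : IPC_axiom a -> le Top a.
Proof.
destruct 1.
- apply (sh_intro _ H), (sh_intro _ H). conjunct.
- do 3 apply (sh_intro _ H). apply (sh_mp _ b).
  + apply (sh_mp _ a); conjunct.
  + apply (sh_mp _ a); conjunct.
- apply sh_top_le, (sh_andl _ H).
- apply sh_top_le, (sh_andr _ H).
- do 2 apply (sh_intro _ H). apply (sh_and _ H); conjunct.
- apply sh_top_le, (sh_orl _ H).
- apply sh_top_le, (sh_orr _ H).
- do 3 apply (sh_intro _ H). apply sh_or_ctx.
  + apply (sh_mp _ a); conjunct.
  + apply (sh_mp _ b); conjunct.
- apply sh_top_le, (sh_bot _ H).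
- apply (sh_refl _ H).
Qed.

Lemma DHMSH_axiom_valid a : DHMSH_axiom a -> le Top a.
Proof.
destruct 1.
- apply sh_top_leH, (sh_orl _ H).
- apply sh_top_leH, (sh_orr _ H).
- do 3 apply sh_introH. apply sh_or_ctx.
  + apply (sh_mpH _ a); conjunct.
  + apply (sh_mpH _ b); conjunct.
- apply sh_top_leH, (sh_andl _ H).
- do 3 apply sh_introH. apply (sh_and _ H); apply (sh_mpH _ c); conjunct.
- apply (sh_refl _ H).
- apply sh_top_leH, (sh_bot _ H).
- do 3 apply sh_introH. apply (sh_mpH _ (a /\ b)%form); [conjunct |].
  apply (sh_and _ H); conjunct.
- do 2 apply sh_introH. apply (sh_mpH _ b); [apply (sh_mpH _ a) |]; conjunct.
- do 3 apply sh_introH; apply (sh_intro _ H).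
  apply (sh_mp _ a); [conjunct | apply (sh_mpH _ b); conjunct].
- do 3 apply sh_introH; apply (sh_intro _ H).
  apply (sh_mpH _ b); [conjunct | apply (sh_mp _ c); conjunct].
- apply sh_top_leH.
  apply (sh_trans _ H _ _ _ (sh_dni _ H _)), (sh_neg _ H), (sh_bot _ H).
- apply sh_top_leH.
  refine (sh_trans _ H _ _ _ (sh_neg _ H _ _ _) (sh_dne _ H _)).
  apply (sh_top _ H).
- apply sh_top_leH, sh_neg_and.
Qed.

Lemma LM_sound (G : form V -> Prop) :
  (forall a, G a -> le Top a) -> forall a, LM_derives G a -> le Top a.
Proof.
intros HG a; induction 1 as [a Ha | a Ha | a b _ IHa _ IHab | a b _ IHab].
- destruct Ha as [a Ha | a | a].
  + exact (IPC_axiom_valid a Ha).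
  + apply sh_top_le, (sh_dni _ H).
  + apply sh_top_le, (sh_dne _ H).
- exact (HG a Ha).
- exact (sh_mp _ _ _ IHab IHa).
- apply sh_top_le, (sh_neg _ H), sh_le_top, IHab.
Qed.

Lemma DMH_sound (G : form V -> Prop) :
  (forall a, G a -> le Top a) -> forall a, DMH_derives G a -> le Top a.
Proof.
intros HG a; induction 1 as [a Ha | a Ha | a b _ IHa _ IHab | a b _ IHab].
- destruct Ha as [a Ha | a b | a b | a | a | a b].
  + exact (DHMSH_axiom_valid a Ha).
  + apply sh_top_leH, sh_neg_or.
  + apply sh_top_leH, sh_or_neg.
  + apply sh_top_leH, (sh_dne _ H).
  + apply sh_top_leH, (sh_dni _ H).
  + apply sh_top_le, (sh_andl _ H).
- exact (HG a Ha).
- exact (sh_mpH _ _ _ IHab IHa).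
- apply sh_top_leH, (sh_neg _ H), sh_le_topH, IHab.
Qed.

End SymHeyting.

(** * The provability preorder of Moisil's logic *)

Section LM.

Context {V : Type} (G : form V -> Prop).

Local Notation D := (LM_derives G).

Lemma LM_weaken a b : D b -> D (a --> b)%form.
Proof. intro hb; exact (LM_MP _ _ _ hb (LM_ax _ _ (LM_IPC _ (IPC_K b a)))). Qed.

Lemma LM_distr a b c : D (a --> (b --> c))%form -> D (a --> b)%form -> D (a --> c)%form.
Proof.
intros habc hab; refine (LM_MP _ _ _ hab (LM_MP _ _ _ habc _)).
apply LM_ax, LM_IPC, IPC_S.
Qed.

Lemma LM_trans a b c : D (a --> b)%form -> D (b --> c)%form -> D (a --> c)%form.
Proof. intros hab hbc; exact (LM_distr _ _ _ (LM_weaken _ _ hbc) hab). Qed.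

Theorem LM_sym_heyting : sym_heyting (fun a b => D (a --> b)%form).
Proof.
split.
- intro a; apply (LM_distr a (a --> a)%form); apply LM_ax, LM_IPC, IPC_K.
- exact LM_trans.
- intro a; apply LM_weaken, LM_ax, LM_IPC, IPC_top.
- intro a; apply LM_ax, LM_IPC, IPC_bot.
- intros a b; apply LM_ax, LM_IPC, IPC_and_l.
- intros a b; apply LM_ax, LM_IPC, IPC_and_r.
- intros a b c ha hb; apply (LM_distr _ b); [| exact hb].
  apply (LM_trans _ a); [exact ha | apply LM_ax, LM_IPC, IPC_and_intro].
- intros a b; apply LM_ax, LM_IPC, IPC_or_l.
- intros a b; apply LM_ax, LM_IPC, IPC_or_r.
- intros a b c ha hb; refine (LM_MP _ _ _ hb (LM_MP _ _ _ ha _)).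
  apply LM_ax, LM_IPC, IPC_or_elim.
- intros a b c h; apply (LM_trans _ (b --> (a /\ b))%form).
  + apply LM_ax, LM_IPC, IPC_and_intro.
  + refine (LM_MP _ _ _ (LM_weaken b _ h) _); apply LM_ax, LM_IPC, IPC_S.
- intros a b c h; apply (LM_distr _ b).
  + apply (LM_trans _ a); [apply LM_ax, LM_IPC, IPC_and_l | exact h].
  + apply LM_ax, LM_IPC, IPC_and_r.
- intros a b; apply LM_CP.
- intro a; apply LM_ax, LM_dni.
- intro a; apply LM_ax, LM_dne.
Qed.

End LM.

(** * Semi-Heyting logic: [-->h] is a Heyting implication *)

Section SemiHeyting.

Context {V : Type} (Ax G : form V -> Prop).
Hypothesis HAx : forall a, DHMSH_axiom a -> Ax a.

Local Notation D := (semi_derives Ax G).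

(** The provability preorder attached to [-->h]. *)
Local Notation "a [<=] b" := (semi_derives Ax G (ImpH a%form b%form))
  (at level 95, no associativity).

Local Ltac axiom := apply semi_ax, HAx; constructor.

Lemma le_K a b : a [<=] (b -->h a).
Proof. apply (semi_SMP _ _ ((a /\ b) -->h a)%form); axiom. Qed.

Lemma le_weaken a b : D b -> a [<=] b.
Proof. intro hb; exact (semi_SMP _ _ _ _ hb (le_K b a)). Qed.

Lemma le_top a : a [<=] Top.
Proof. apply le_weaken; axiom. Qed.

Lemma le_andl a b : (a /\ b) [<=] a.
Proof. axiom. Qed.

Lemma le_and a b c : c [<=] a -> c [<=] b -> c [<=] (a /\ b).
Proof.
intros ha hb; refine (semi_SMP _ _ _ _ hb (semi_SMP _ _ _ _ ha _)); axiom.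
Qed.

Lemma le_curry a b c : (a /\ b) [<=] c -> a [<=] (b -->h c).
Proof. intro h; refine (semi_SMP _ _ _ _ h _); axiom. Qed.

Lemma le_uncurry a b c : a [<=] (b -->h c) -> (a /\ b) [<=] c.
Proof. intro h; refine (semi_SMP _ _ _ _ h _); axiom. Qed.

Lemma Imp_congr_l a b c : a [<=] b -> b [<=] a -> (a --> c) [<=] (b --> c).
Proof.
intros hab hba; refine (semi_SMP _ _ _ _ hba (semi_SMP _ _ _ _ hab _)); axiom.
Qed.

Lemma Imp_congr_r a b c : a [<=] b -> b [<=] a -> (c --> b) [<=] (c --> a).
Proof.
intros hab hba; refine (semi_SMP _ _ _ _ hba (semi_SMP _ _ _ _ hab _)); axiom.
Qed.

(** The formula [a -->h Top] is [a --> (a /\ Top)], and [a /\ Top] may be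
    replaced by the equivalent [a /\ a]. *)
Lemma le_refl a : a [<=] a.
Proof.
refine (semi_SMP _ _ _ _ (le_top a) (Imp_congr_r (a /\ a)%form (a /\ Top)%form a _ _));
  apply le_and; try apply le_andl; apply le_top.
Qed.

Lemma le_andr a b : (a /\ b) [<=] b.
Proof. apply le_uncurry, le_weaken, le_refl. Qed.

(** Transitivity when the first inequality is an equivalence.  From [a [<=] b]
    one gets [(c /\ a) [<=] b] by weakening and uncurrying but not yet
    [(a /\ c) [<=] b], so the conjunction is commuted before and after the
    replacement. *)
Lemma le_congr_l a b c : a [<=] b -> b [<=] a -> a [<=] c -> b [<=] c.
Proof.
intros hab hba hac.
assert (comm : forall x y, (x /\ y) [<=] (y /\ x)).
{ intros x y; apply le_and; [apply le_andr | apply le_andl]. }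
assert (repl : forall x y, x [<=] y -> (c /\ x) [<=] (c /\ y)).
{ intros x y hxy; apply le_and; [apply le_andl | apply le_uncurry, le_weaken, hxy]. }
unfold ImpH at 1.
refine (semi_SMP _ _ _ _ _ (Imp_congr_r _ (c /\ b)%form _ (comm _ _) (comm _ _))).
refine (semi_SMP _ _ _ _ _
          (Imp_congr_r _ (c /\ a)%form _ (repl _ _ hba) (repl _ _ hab))).
refine (semi_SMP _ _ _ _ _ (Imp_congr_r _ (a /\ c)%form _ (comm _ _) (comm _ _))).
exact (semi_SMP _ _ _ _ hac (Imp_congr_l _ _ _ hab hba)).
Qed.

(** If [a [<=] b] then [a] is equivalent to [a /\ b], and [a /\ b [<=] c] holds
    by weakening and uncurrying. *)
Lemma le_trans a b c : a [<=] b -> b [<=] c -> a [<=] c.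
Proof.
intros hab hbc; apply (le_congr_l (a /\ b)%form).
- apply le_andl.
- apply le_and; [apply le_refl | exact hab].
- apply le_uncurry, le_weaken, hbc.
Qed.

Lemma le_mpH h a b : h [<=] (a -->h b) -> h [<=] a -> h [<=] b.
Proof.
intros hab ha; apply (le_trans _ (h /\ a)%form).
- apply le_and; [apply le_refl | exact ha].
- apply le_uncurry, hab.
Qed.

Lemma le_or a b c : a [<=] c -> b [<=] c -> (a \/ b) [<=] c.
Proof.
intros ha hb; refine (semi_SMP _ _ _ _ hb (semi_SMP _ _ _ _ ha _)); axiom.
Qed.

Lemma Imp_congr_l_ctx h a b c :
  (h /\ a) [<=] b -> (h /\ b) [<=] a -> h [<=] (a --> c) -> h [<=] (b --> c).
Proof.
intros hab hba; apply le_mpH.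
apply (le_mpH _ (b -->h a)%form); [| apply le_curry, hba].
apply (le_mpH _ (a -->h b)%form); [| apply le_curry, hab].
apply le_weaken; axiom.
Qed.

Lemma le_Top_Imp b : (Top --> b) [<=] b.
Proof.
apply (le_mpH _ Top); [| apply le_top].
apply (Imp_congr_r (Top /\ b)%form b).
- apply le_andr.
- apply le_and; [apply le_top | apply le_refl].
Qed.

(** Modus ponens for the primitive implication: under [a], the antecedent [a] is
    equivalent to [Top]. *)
Lemma le_Imp_ImpH a b : (a --> b) [<=] (a -->h b).
Proof.
apply le_curry, (le_trans _ (Top --> b)%form); [| apply le_Top_Imp].
apply (Imp_congr_l_ctx _ a).
- apply le_top.
- apply (le_trans _ ((a --> b) /\ a)%form); [apply le_andl | apply le_andr].
- apply le_andl.
Qed.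

(** The derivability of [(a /\ b) --> a] is what distinguishes Heyting from
    semi-Heyting implications: under [a -->h b], the antecedent [a] may replace
    [a /\ b] in [(a /\ b) --> b]. *)
Lemma le_ImpH_Imp a b :
  (forall x y, D ((x /\ y) --> x)%form) -> (a -->h b) [<=] (a --> b).
Proof.
intro heyting; apply (Imp_congr_l_ctx _ (a /\ b)%form).
- apply (le_trans _ (a /\ b)%form); [apply le_andr | apply le_andl].
- apply le_and; [apply le_andr | apply le_uncurry, le_refl].
- apply le_weaken, (semi_SMP _ _ _ _ (heyting b a)), Imp_congr_l;
    apply le_and; (apply le_andl || apply le_andr).
Qed.

End SemiHeyting.

(** * The provability preorder of the De Morgan Heyting logic *)

Theorem DMH_sym_heyting {V : Type} (G : form V -> Prop) :
  sym_heyting (fun a b => DMH_derives G (a -->h b)%form).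
Proof.
pose proof (@DMH_base V) as base.
split.
- exact (le_refl _ _ base).
- exact (le_trans _ _ base).
- exact (le_top _ _ base).
- intro a; apply semi_ax, base, A7.
- exact (le_andl _ _ base).
- exact (le_andr _ _ base).
- exact (le_and _ _ base).
- intros a b; apply semi_ax, base, A1.
- intros a b; apply semi_ax, base, A2.
- exact (le_or _ _ base).
- intros a b c h; apply (le_trans _ _ base _ (b -->h c)%form).
  + exact (le_curry _ _ base _ _ _ h).
  + apply (le_ImpH_Imp _ _ base); intros x y; apply semi_ax, DMH_heyting.
- intros a b c h; apply (le_uncurry _ _ base), (le_trans _ _ base _ _ _ h).
  apply (le_Imp_ImpH _ _ base).
- intros a b; apply semi_SCP.
- intro a; apply semi_ax, DMH_dni.
- intro a; apply semi_ax, DMH_dne.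
Qed.

Theorem corollary5p11 (V : Type) :
  logic_equivalent (@LM_derives V) (@DMH_derives V).
Proof.
intros G a; split; intro h.
- apply (semi_SMP _ _ Top); [apply semi_ax, DMH_base, A6 |].
  refine (LM_sound _ (DMH_sym_heyting G) G _ a h).
  intros g hg; apply (le_weaken _ _ (@DMH_base V)), semi_prem, hg.
- apply (LM_MP _ Top); [apply LM_ax, LM_IPC, IPC_top |].
  refine (DMH_sound _ (LM_sym_heyting G) G _ a h).
  intros g hg; apply LM_weaken, LM_prem, hg.
Qed.
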